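(* Let $R$ be a ring and let $M$ be a quasi projective, finitely generated, $1$-epi-retractable left $R$-module. Then $M$ is virtually semisimple if and only if $\mathrm{End}({}_RM)$ is a semiprime principal left ideal ring.
   Context: All rings are associative with identity (not necessarily commutative) and all modules are unitary left modules. Endomorphisms of a left module are written on the right: in $\mathrm{End}({}_RM)$ the product $gf$ means first apply $g$, then $f$ (so that $\mathrm{End}({}_RR)\cong R$). A module $M$ is virtually semisimple if each submodule of $M$ is isomorphic to a direct summand of $M$. A module $P$ is $M$-projective if for every surjective homomorphism $M\to N$ of modules, every homomorphism $P\to N$ lifts to a homomorphism $P\to M$; $M$ is quasi projective if $M$ is $M$-projective. $M$ is $1$-epi-retractable if for every cyclic submodule $N$ of $M$ there exists an epimorphism $M\to N$. A principal left ideal ring is a ring in which every left ideal is principal. A ring is semiprime if it has no nonzero two-sided ideal $I$ with $I^2=0$. *)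

(* Defs.v *)
From HB Require Import structures.
From mathcomp Require Import all_boot all_algebra.
From mathcomp Require Import boolp.

Set Implicit Arguments.
Unset Strict Implicit.
Unset Printing Implicit Defensive.

Import GRing.Theory.
Local Open Scope ring_scope.

(* Rings are [pzRingType]s, so the zero ring is allowed; it does occur here, as
   the endomorphism ring of the zero module.  Submodules are boolean
   predicates; under the classical axioms of [boolp] these are all subsets. *)

Section Submodules.
Variables (R : pzRingType) (M : lmodType R).

Record submod (N : submodClosed M) : predArgType :=
  Submod { submod_val : M; submod_valP : submod_val \in N }.

HB.instance Definition _ (N : submodClosed M) := [isSub for @submod_val N].
HB.instance Definition _ (N : submodClosed M) := [Choice of submod N by <:].
HB.instance Definition _ (N : submodClosed M) :=
  [SubChoice_isSubLmodule of submod N by <:].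

Definition direct_summand (K : submodClosed M) : Prop :=
  exists L : submodClosed M,
    (forall x : M, exists y z, [/\ y \in K, z \in L & x = y + z]) /\
    (forall x : M, x \in K -> x \in L -> x = 0).

Definition cyclic_submod (N : submodClosed M) : Prop :=
  exists x : M, forall y : M, y \in N <-> exists a : R, y = a *: x.

Definition finitely_generated : Prop :=
  exists s : seq M, forall x : M,
    exists c : 'I_(size s) -> R, x = \sum_(i < size s) c i *: s`_i.

End Submodules.

Section ModuleProperties.
Variable R : pzRingType.
Implicit Types M P U V : lmodType R.

Definition surjective (S T : Type) (f : S -> T) : Prop :=
  forall y, exists x, f x = y.

Definition isomorphic U V : Prop := exists f : {linear U -> V}, bijective f.

Definition virtually_semisimple M : Prop :=
  forall N : submodClosed M,
    exists K : submodClosed M, direct_summand K /\ isomorphic (submod N) (submod K).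

Definition relatively_projective M P : Prop :=
  forall (N : lmodType R) (g : {linear M -> N}), surjective g ->
  forall f : {linear P -> N},
    exists h : {linear P -> M}, forall x : P, g (h x) = f x.

Definition quasi_projective M : Prop := relatively_projective M M.

Definition one_epi_retractable M : Prop :=
  forall N : submodClosed M, cyclic_submod N ->
    exists f : {linear M -> submod N}, surjective f.

End ModuleProperties.

Section RingProperties.
Variable A : pzRingType.

(* The left ideals of A are the submodules of the left regular module A^o,
   whose scaling [a *: x] is [a * x]. *)
Definition principal_left_ideal_ring : Prop :=
  forall I : submodClosed A^o, cyclic_submod I.

Definition two_sided_ideal (I : {pred A}) : Prop :=
  zmod_closed I /\
  (forall a x : A, x \in I -> a * x \in I /\ x * a \in I).

Definition in_ideal_product (I J : {pred A}) (x : A) : Prop :=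
  exists s : seq (A * A),
    (forall p, p \in s -> p.1 \in I /\ p.2 \in J) /\
    x = \sum_(p <- s) p.1 * p.2.

Definition semiprime_ring : Prop :=
  forall I : {pred A}, two_sided_ideal I ->
    (forall x, in_ideal_product I I x -> x = 0) ->
    forall x, x \in I -> x = 0.

End RingProperties.

Definition endo (R : pzRingType) (M : lmodType R) : Type := {linear M -> M}.

Section EndomorphismRing.
Variables (R : pzRingType) (M : lmodType R).
Local Notation E := (endo M).
Implicit Types f g h : E.

HB.instance Definition _ := gen_eqMixin E.
HB.instance Definition _ := gen_choiceMixin E.

Definition endo_app f (x : M) : M := (f : {linear M -> M}) x.

Lemma endoP f g : endo_app f =1 endo_app g -> f = g.
Proof.
move=> fg; have {fg} : endo_app f = endo_app g by apply/funext.
case: f => f [[fN] [fZ]]; case: g => g [[gN] [gZ]].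
rewrite /endo_app /= => fg; have {}fg : f = g := fg.
move: gN gZ; rewrite -fg => gN gZ.
by rewrite (Prop_irrelevance fN gN) (Prop_irrelevance fZ gZ).
Qed.

Definition endo_zero : E := (\0 : {linear M -> M}).
Definition endo_opp f : E := (\- (f : {linear M -> M}) : {linear M -> M}).
Definition endo_add f g : E :=
  ((f : {linear M -> M}) \+ (g : {linear M -> M}) : {linear M -> M}).
Definition endo_one : E := (idfun : {linear M -> M}).
(* Endomorphisms act on the right: [g * f] applies g first, then f. *)
Definition endo_mul g f : E :=
  ((f : {linear M -> M}) \o (g : {linear M -> M}) : {linear M -> M}).

Fact endo_addA : associative endo_add.
Proof. by move=> f g h; apply: endoP => x; apply: addrA. Qed.
Fact endo_addC : commutative endo_add.
Proof. by move=> f g; apply: endoP => x; apply: addrC. Qed.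
Fact endo_add0 : left_id endo_zero endo_add.
Proof. by move=> f; apply: endoP => x; apply: add0r. Qed.
Fact endo_addN : left_inverse endo_zero endo_opp endo_add.
Proof. by move=> f; apply: endoP => x; apply: addNr. Qed.

HB.instance Definition _ := GRing.isZmodule.Build E
  endo_addA endo_addC endo_add0 endo_addN.

Fact endo_mulA : associative endo_mul.
Proof. by move=> f g h; apply: endoP. Qed.
Fact endo_mul1 : left_id endo_one endo_mul.
Proof. by move=> f; apply: endoP. Qed.
Fact endo_mulr1 : right_id endo_one endo_mul.
Proof. by move=> f; apply: endoP. Qed.
Fact endo_mulDl : left_distributive endo_mul endo_add.
Proof.
by move=> f g h; apply: endoP => x; apply: (raddfD (h : {linear M -> M})).
Qed.
Fact endo_mulDr : right_distributive endo_mul endo_add.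
Proof. by move=> f g h; apply: endoP. Qed.

HB.instance Definition _ := GRing.Zmodule_isPzRing.Build E
  endo_mulA endo_mul1 endo_mulr1 endo_mulDl endo_mulDr.

End EndomorphismRing.

(* Main.v *)
Require Import Defs.
From HB Require Import structures.
From mathcomp Require Import all_boot all_algebra.
From mathcomp Require Import boolp classical_sets.

Set Implicit Arguments.
Unset Strict Implicit.
Unset Printing Implicit Defensive.

Import GRing.Theory.
Local Open Scope ring_scope.

(** Write E for the endomorphism ring, acting on the right, so that a left
ideal I of E has a trace M I, the submodule generated by the images of its
members.

If M is virtually semisimple, then every submodule N of M is a retract: there
are p : M -> N and s : N -> M such that s followed by p is the identity of N
([virtually_semisimpleP]).  Since M is quasi projective and finitely generated,
a left ideal I of E consists of all endomorphisms with image in M I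
([mem_of_trace]).  Taking N = M I, the map p then belongs to I, and every f in I
equals f followed by s and then p; so I = E p.

For semiprimeness, let I be an ideal with I I = 0 and let J be its right
annihilator.  Retractability and I I = 0 make the trace M J essential in M.
A split epimorphism p from M onto an essential submodule is injective: M is
noetherian, so the kernels of the powers of p become stationary, while the
images of all powers of p stay essential and so meet ker p unless it is zero
([injective_of_essential_image]).  As p lies in J, it is injective and killed by
I, hence I = 0.

Conversely, let E be a semiprime principal left ideal ring and N a submodule of
M.  The left ideal of endomorphisms with image in N is E p for some p, and
retractability gives M p = N.  It remains to split p, for which it is enough to
find e in E with e p = p such that x p = 0 implies x e = 0: then x p |-> x e is
a section ([annihilator_idempotent]).  Choose a left ideal J maximal with
E p and J independent; then E p + J is essential and equal to E c for some c.
The same stationarity argument, applied to right multiplication by c, shows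
that x c = 0 implies x = 0; here semiprimeness enters through the vanishing of
the left singular ideal ([left_singular0]), which makes right multiplication by
c preserve essential left ideals.  Writing p = b c and c = a p + j with j in J,
independence gives p = b a p, and e = b a works. *)

(** * Submodules, linear maps and quotients *)

Section ModuleConstructions.
Variable R : pzRingType.
Implicit Types U V : lmodType R.

(** Classically, a submodule may be given by an arbitrary property closed under
linear combinations. *)
Lemma submod_of_closed V (P : V -> Prop) :
  P 0 -> (forall a x y, P x -> P y -> P (a *: x + y)) ->
  exists N : submodClosed V, forall x, x \in N <-> P x.
Proof.
move=> P0 PZD; pose S : {pred V} := fun x => `[<P x>].
have S_closed : subsemimod_closed S.
  split; first split.
  - exact/asboolP.
  - move=> x y /asboolP Px /asboolP Py; apply/asboolP.
    by rewrite -[x]scale1r; apply: PZD.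
  - move=> a x /asboolP Px; apply/asboolP.
    by rewrite -[a *: x]addr0; apply: PZD.
pose S_mix := GRing.isSubmodClosed.Build R V S S_closed.
pose N : submodClosed V := HB.pack S S_mix.
by exists N => x; split => /asboolP.
Qed.

Lemma val_in V (N : submodClosed V) (n : submod N) : val n \in N.
Proof. exact: valP. Qed.

Lemma submodN V (N : submodClosed V) x : x \in N -> - x \in N.
Proof. by move=> Nx; rewrite -scaleN1r rpredZ. Qed.

Lemma submodB V (N : submodClosed V) x y : x \in N -> y \in N -> x - y \in N.
Proof. by move=> Nx Ny; rewrite rpredD // submodN. Qed.

(** A submodule of U * V that projects onto U and meets 0 * V trivially is the
graph of a linear map; this builds maps whose values are only determined by a
property, such as a map on a quotient or the section of an epimorphism. *)
Lemma linear_of_relation U V (P : U -> V -> Prop) :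
  (forall x, exists y, P x y) -> (forall y, P 0 y -> y = 0) ->
  (forall a x y x' y', P x y -> P x' y' -> P (a *: x + x') (a *: y + y')) ->
  exists f : {linear U -> V}, forall x, P x (f x).
Proof.
move=> /choice[f Pf] P0 PZD.
have P_uniq x y y' : P x y -> P x y' -> y = y'.
  move=> Py Py'; apply/eqP; rewrite -subr_eq0 addrC -scaleN1r; apply/eqP.
  by apply: P0; rewrite -[0](addNr x) -[- x]scaleN1r; apply: PZD.
have f_lin : linear f.
  by move=> a x y; apply: (P_uniq (a *: x + y)) => //; apply: PZD.
pose f_mix := GRing.isLinear.Build R U V *:%R f f_lin.
by exists (HB.pack f f_mix : {linear U -> V}).
Qed.

Lemma corestriction U V (N : submodClosed V) (f : {linear U -> V}) :
  (forall x, f x \in N) ->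
  exists g : {linear U -> submod N}, forall x, val (g x) = f x.
Proof.
move=> fN; apply: (linear_of_relation (P := fun x y => val y = f x)).
- by move=> x; exists (Submod (fN x)).
- by move=> y y0; apply: val_inj; rewrite y0 !raddf0.
- by move=> a x y x' y' yE y'E; rewrite linearP -yE -y'E.
Qed.

Section Quotient.
Variables (V : lmodType R) (N : submodClosed V).

(** [submodClosed] does not record closure under opposites, as it also serves
semirings; this copy of N carries it, as the group quotient requires. *)
Definition quotient_kernel : {pred V} := fun x => x \in N.

Fact quotient_kernel_closed : zmod_closed quotient_kernel.
Proof. by split=> [|x y]; [apply: rpred0 | apply: submodB]. Qed.

HB.instance Definition _ :=
  GRing.isZmodClosed.Build V quotient_kernel quotient_kernel_closed.

Definition quotient_module : Type := Quotient.quot quotient_kernel.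
Local Notation Q := quotient_module.

HB.instance Definition _ := GRing.Zmodule.on Q.

Let proj : V -> Q := fun x => \pi_(Quotient.quot quotient_kernel)%qT x.
Let rep : Q -> V := fun q => repr q.

Let projD x y : proj (x + y) = proj x + proj y.
Proof. exact: raddfD. Qed.

Let proj_rep q : proj (rep q) = q.
Proof. exact: reprK. Qed.

Let proj_eq x y : proj x = proj y <-> x - y \in N.
Proof.
rewrite -[x - y \in N]/(x - y \in quotient_kernel) Quotient.idealrBE.
by split=> [/eqP|/eqP].
Qed.

Let proj_scale a x y : proj x = proj y -> proj (a *: x) = proj (a *: y).
Proof. by rewrite !proj_eq -scalerBr => Nxy; apply: rpredZ. Qed.

Let scale (a : R) (q : Q) : Q := proj (a *: rep q).

Let scale_proj a x : scale a (proj x) = proj (a *: x).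
Proof. by apply: proj_scale; rewrite proj_rep. Qed.

Fact quotient_scalerA a b q : scale a (scale b q) = scale (a * b) q.
Proof. by rewrite -[q]proj_rep !scale_proj scalerA. Qed.

Fact quotient_scale1r : left_id 1 scale.
Proof. by move=> q; rewrite -[q]proj_rep !scale_proj scale1r. Qed.

Fact quotient_scalerDr : right_distributive scale +%R.
Proof.
move=> a q r; rewrite -[q]proj_rep -[r]proj_rep -projD !scale_proj.
by rewrite scalerDr projD.
Qed.

Fact quotient_scalerDl q : {morph scale^~ q : a b / a + b}.
Proof.
by move=> a b; rewrite -[q]proj_rep !scale_proj scalerDl projD.
Qed.

HB.instance Definition _ := GRing.Zmodule_isLmodule.Build R Q
  quotient_scalerA quotient_scale1r quotient_scalerDr quotient_scalerDl.

Lemma quotient_exists :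
  exists (W : lmodType R) (pi : {linear V -> W}),
    surjective pi /\ forall x, pi x = 0 <-> x \in N.
Proof.
have proj_lin : linear proj.
  by move=> a x y; rewrite projD; congr (_ + _); rewrite -scale_proj.
pose proj_mix := GRing.isLinear.Build R V Q *:%R proj proj_lin.
pose pi : {linear V -> Q} := HB.pack proj proj_mix.
exists Q, pi; split=> [q | x]; first by exists (rep q); apply: proj_rep.
by rewrite -(raddf0 pi) proj_eq subr0.
Qed.

End Quotient.

(** * Virtually semisimple modules and retracts *)

Definition retract (M U : lmodType R) : Prop :=
  exists (p : {linear M -> U}) (s : {linear U -> M}), forall u, p (s u) = u.

(** A retraction p with section s cuts the summand s N out of M, with complement
ker p. *)
Lemma virtually_semisimpleP M :
  virtually_semisimple M <-> forall N : submodClosed M, retract M (submod N).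
Proof.
split=> [vsM N | retrM N].
  have [K [[L [MKL KL0]] [f [g fK gK]]]] := vsM N.
  (* the projection onto K along L, followed by K -> N *)
  pose P (x : M) (n : submod N) := exists2 z, z \in L & x = val (f n) + z.
  have [||| p pP] := @linear_of_relation M (submod N) P.
  - move=> x; have [y [z [Ky Lz ->]]] := MKL x.
    by exists (g (Submod Ky)), z; rewrite ?gK.
  - move=> n [z Lz /esym/eqP]; rewrite addr_eq0 => /eqP fnE.
    apply: (can_inj fK); rewrite raddf0; apply: val_inj.
    apply: KL0; first exact: val_in.
    by rewrite fnE submodN.
  - move=> a x n x' n' [z Lz ->] [z' Lz' ->]; exists (a *: z + z').
      by rewrite rpredD // rpredZ.
    by rewrite linearP /= scalerDr addrACA.
  have [||| s sP] :=
    @linear_of_relation (submod N) M (fun n x => x = val (f n)).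
  - by move=> n; exists (val (f n)).
  - by move=> x ->; rewrite raddf0.
  - by move=> a n x n' x' -> ->; rewrite linearP.
  exists p, s => n; have [z Lz] := pP (s n).
  move: (p (s n)) => k; rewrite sP => fnE.
  apply: (can_inj fK); apply: val_inj; apply/eqP; rewrite -subr_eq0; apply/eqP.
  apply: KL0; first by rewrite submodB // val_in.
  by rewrite -opprB fnE addrAC subrr add0r submodN.
have [p [s psK]] := retrM N.
have [||K KP] := @submod_of_closed M (fun x => s (p x) = x).
- by rewrite !raddf0.
- by move=> a x y xE yE; rewrite !linearP xE yE.
have [||L LP] := @submod_of_closed M (fun x => p x = 0).
- by rewrite raddf0.
- by move=> a x y x0 y0; rewrite linearP x0 y0 scaler0 addr0.
exists K; split.
  exists L; split=> [x | x /KP xE /LP px0]; last by rewrite -xE px0 raddf0.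
  exists (s (p x)), (x - s (p x)); split.
  - by apply/KP; rewrite psK.
  - by apply/LP; rewrite raddfB /= psK subrr.
  - by rewrite addrC subrK.
have sK n : s n \in K by apply/KP; rewrite psK.
have [f fE] := corestriction sK.
exists f; exists (fun k => p (val k)) => [n | k]; first by rewrite fE psK.
by apply: val_inj; rewrite fE; apply/KP/val_in.
Qed.

(** * Essential submodules and the ascending chain condition *)

Lemma cyclic_epi V (N : submodClosed V) :
  cyclic_submod N -> exists p : {linear R^o -> submod N}, surjective p.
Proof.
move=> [g gP]; have mulgN (a : R) : a *: g \in N by apply/gP; exists a.
have [|||p pP] := @linear_of_relation R^o (submod N)
  (fun a n => val n = (a : R) *: g).
- by move=> a; exists (Submod (mulgN a)).
- by move=> n n0; apply: val_inj; rewrite n0 scale0r raddf0.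
- move=> a b n b' n' nE n'E.
  by rewrite [RHS]scalerDl -scalerA -nE -n'E.
exists p => n; have /gP[a nE] := val_in n.
by exists a; apply: val_inj; rewrite pP nE.
Qed.

(** W is a plain property, so that images and sums of submodules can be written
down directly. *)
Definition essential V (W : V -> Prop) : Prop :=
  forall x, x <> 0 -> exists2 a, a *: x <> 0 & W (a *: x).

Definition noetherian V : Prop :=
  forall F : nat -> submodClosed V, (forall n x, x \in F n -> x \in F n.+1) ->
    exists n, forall x, x \in F n.+1 -> x \in F n.

(** If U is the union of the chain and p : V -> U is onto, then p sends the
finitely many generators of V into one member of the chain, which is therefore
all of U. *)
Lemma noetherian_of_epi V :
  finitely_generated V ->
  (forall N : submodClosed V,
    exists p : {linear V -> submod N}, surjective p) ->
  noetherian V.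
Proof.
move=> [t t_gen] epi F F_step.
have F_le m n x : (m <= n)%N -> x \in F m -> x \in F n.
  move=> le_mn; rewrite -(subnK le_mn).
  by elim: (n - m)%N => // k IHk /IHk; apply: F_step.
have [||U UP] := @submod_of_closed V (fun x => exists n, x \in F n).
- by exists 0%N; apply: rpred0.
- move=> a x y [m Fx] [n Fy]; exists (maxn m n); rewrite rpredD ?rpredZ //.
    by apply: F_le Fx; apply: leq_maxl.
  by apply: F_le Fy; apply: leq_maxr.
have [p p_surj] := epi U.
have [n Fn] : exists n, forall x, x \in t -> val (p x) \in F n.
  elim: t {t_gen} => [|x t [n Fn]]; first by exists 0%N.
  have /UP[m Fm] := val_in (p x).
  exists (maxn m n) => y; rewrite inE => /predU1P[-> | /Fn Fy].
    by apply: F_le Fm; apply: leq_maxl.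
  by apply: F_le Fy; apply: leq_maxr.
exists n => x Fx.
have Ux : x \in U by apply/UP; exists n.+1.
have [y yE] := p_surj (Submod Ux).
rewrite -[x]/(val (Submod Ux)) -yE; have [c ->] := t_gen y.
rewrite !raddf_sum /=; apply: rpred_sum => i _.
by rewrite !linearZ /= rpredZ // Fn // mem_nth.
Qed.

(** The kernels of the powers of f are stationary from some n on, so ker f meets
the image of f ^ n trivially; but that image is essential, by induction on n. *)
Lemma injective_of_essential_image V (f : {linear V -> V}) :
  noetherian V ->
  (forall W, essential W -> essential (fun y => exists2 x, W x & y = f x)) ->
  forall x, f x = 0 -> x = 0.
Proof.
move=> noethV f_ess x fx0.
have /choice[F FP] n :
    exists N : submodClosed V, forall y, y \in N <-> iter n f y = 0.
  apply: submod_of_closed; first by elim: n => //= n ->; rewrite raddf0.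
  move=> a y z y0 z0.
  suff -> : iter n f (a *: y + z) = a *: iter n f y + iter n f z.
    by rewrite y0 z0 scaler0 addr0.
  by elim: n {y0 z0} => //= n ->; rewrite linearP.
have [n y | n nP] := noethV F.
  by rewrite !FP iterS => ->; rewrite raddf0.
have ess_n m : essential (fun y => exists z, y = iter m f z).
  elim: m => [|m IHm] y y0; first by exists 1; [|exists y]; rewrite scale1r.
  have [a ay0 [_ [z ->] ayE]] := f_ess _ IHm y y0.
  by exists a => //; exists z.
apply: contrapT => x0; have [a ax0 [z axE]] := ess_n n x x0.
apply: ax0; rewrite axE; apply/FP/nP/FP.
by rewrite iterS -axE linearZ /= fx0 scaler0.
Qed.

(** By Zorn's lemma, take J maximal among the submodules independent of N: if x
is not in J, then J + R x meets N nontrivially, and this gives a nonzero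
multiple of x in N + J. *)
Lemma complement_exists V (N : submodClosed V) :
  exists J : submodClosed V,
    (forall x, x \in N -> x \in J -> x = 0) /\
    essential (fun x => exists y z, [/\ y \in N, z \in J & x = y + z]).
Proof.
(* Not asking for 0 in S makes the empty union, and hence every union of a
   chain, satisfy P; the maximal S contains 0 all the same. *)
pose P (S : set V) :=
  (forall a x y, S x -> S y -> S (a *: x + y)) /\
  (forall x, x \in N -> S x -> x = 0).
have [F FP F_tot | S [[SZD SN0] S_max]] := @Zorn_bigcup V P.
  split; last by move=> x Nx [A FA Ax]; apply: (FP A FA).2.
  move=> a x y [A FA Ax] [B FB By].
  have [sAB | sBA] := F_tot A B FA FB.
    by exists B => //; apply: (FP B FB).1 => //; apply: sAB.
  by exists A => //; apply: (FP A FA).1 => //; apply: sBA.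
(* Otherwise S + R x would be larger than S and still independent of N. *)
have maxS x : (forall a z, (z = 0 \/ S z) -> a *: x + z \in N ->
    a *: x + z = 0) -> S x.
  move=> xN0; pose B y := exists a z, (z = 0 \/ S z) /\ y = a *: x + z.
  have sSB : (S `<=` B)%classic.
    by move=> y Sy; exists 0, y; rewrite scale0r add0r; split; [right|].
  apply: contrapT => nSx; apply: (S_max B).
    split=> // sBS; apply: nSx; apply: sBS; exists 1, 0.
    by rewrite scale1r addr0; split; [left|].
  split; last first.
    move=> y Ny [a [z [Sz yE]]].
    by rewrite yE in Ny *; apply: xN0.
  move=> c _ _ [a [z [Sz ->]]] [b [w [Sw ->]]].
  exists (c * a + b), (c *: z + w); split; last first.
    by rewrite scalerDr scalerA addrACA scalerDl.
  case: Sz Sw => [-> | Sz] [-> | Sw].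
  - by left; rewrite scaler0 addr0.
  - by right; rewrite scaler0 add0r.
  - by right; apply: (SZD) => //; rewrite -[0](addNr z) -scaleN1r; apply: SZD.
  - by right; apply: SZD.
have S0 : S 0.
  apply: maxS => a z Sz; rewrite scaler0 add0r.
  by case: Sz => [-> | Sz Nz] //; apply: SN0.
have [J JS] := submod_of_closed S0 SZD.
exists J; split=> [x Nx /JS | x x0]; first exact: SN0.
have [Sx | nSx] := EM (S x).
  exists 1; rewrite scale1r //; exists 0, x; rewrite add0r rpred0.
  by split=> //; apply/JS.
have [a [z [Sz Naxz axz0]]] : exists a z,
    [/\ S z, a *: x + z \in N & a *: x + z <> 0].
  apply: contrapT => nex; apply: nSx; apply: maxS => a z Sz Naxz.
  apply: contrapT => axz0; apply: nex; exists a, z; split=> //.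
  by case: Sz => [->|].
exists a; last first.
  exists (a *: x + z), (- z); rewrite addrK; split=> //.
  by rewrite submodN //; apply/JS.
move=> ax0; apply: axz0; move: Naxz; rewrite ax0 add0r => Nz.
exact: SN0.
Qed.

End ModuleConstructions.

(** * Semiprime principal left ideal rings *)

Section SemiprimePrincipalRings.
Variable A : pzRingType.
Hypothesis A_semiprime : semiprime_ring A.
Hypothesis A_plir : principal_left_ideal_ring A.

Lemma left_ideal_generator (P : A -> Prop) :
  P 0 -> (forall a x y, P x -> P y -> P (a * x + y)) ->
  exists2 g, P g & forall x, P x -> exists a, x = a * g.
Proof.
move=> P0 PZD; have [I IP] := @submod_of_closed A A^o P P0 PZD.
have [g gP] := A_plir I; exists g.
  by apply/IP/gP; exists 1; rewrite scale1r.
by move=> x /IP/gP.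
Qed.

Lemma regular_noetherian : @noetherian A A^o.
Proof.
apply: noetherian_of_epi.
  by exists [:: 1] => x; exists (fun=> x); rewrite big_ord1 /= [RHS]mulr1.
by move=> N; apply: cyclic_epi (A_plir N).
Qed.

(** As z A is contained in A z, the left ideal A z ^ n is two-sided.  If
z ^ (n + 1) = 0 with n > 0, its square is zero because 2 n >= n + 1, so
z ^ n = 0 by semiprimeness; descend to the exponent 1. *)
Lemma nilpotent_generator (z : A) n :
  (forall a, exists b, z * a = b * z) -> z ^+ n = 0 -> z = 0.
Proof.
move=> z_normal; elim: n => [z0 | n IHn zn0].
  by rewrite -[z]mulr1 -[1]/(z ^+ 0) z0 mulr0.
case: n IHn zn0 => [_|n IHn zn0]; first by rewrite expr1.
have zn_normal m a : exists b, z ^+ m * a = b * z ^+ m.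
  elim: m a => [|m IHm] a; first by exists a; rewrite mul1r mulr1.
  have [b zaE] := z_normal a; have [c zbE] := IHm b.
  by exists c; rewrite exprSr -mulrA zaE mulrA zbE -mulrA.
pose I : {pred A} := fun x => `[<exists a, x = a * z ^+ n.+1>].
have I_ideal : two_sided_ideal I.
  split; first split.
  - by apply/asboolP; exists 0; rewrite mul0r.
  - move=> x y /asboolP[a ->] /asboolP[b ->].
    by apply/asboolP; exists (a - b); rewrite mulrBl.
  - move=> a x /asboolP[b ->]; split; apply/asboolP.
      by exists (a * b); rewrite mulrA.
    have [c zaE] := zn_normal n.+1 a.
    by exists (b * c); rewrite -mulrA zaE mulrA.
apply: IHn; apply: (A_semiprime I_ideal); last first.
  by apply/asboolP; exists 1; rewrite mul1r.
move=> x [t [tI ->]]; rewrite big1_seq // => q /andP[_ /tI[]].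
move=> /asboolP[a ->] /asboolP[b ->]; have [c zbE] := zn_normal n.+1 b.
have z2n0 : z ^+ n.+1 * z ^+ n.+1 = 0.
  by rewrite -exprD addSnnS addnC exprD zn0 mul0r.
by rewrite -mulrA [z ^+ _ * _]mulrA zbE -mulrA z2n0 !mulr0.
Qed.

Definition left_singular (z : A) : Prop :=
  @essential A A^o (fun y => (y : A) * z = 0).

(** The left singular elements form a two-sided ideal A g.  The left
annihilators of the powers of g are stationary from some n on; were g ^ n
nonzero, it would have a nonzero multiple a g ^ n killed by g, against
stationarity.  So g is nilpotent, hence zero. *)
Lemma left_singular0 z : left_singular z -> z = 0.
Proof.
move=> z_sing.
have mulL_sing (a w : A) : left_singular w -> left_singular (a * w).
  move=> w_sing y y0; have [ya0 | ya0] := EM ((y : A) * a = 0).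
    by exists 1; rewrite scale1r // mulrA ya0 mul0r.
  have [b bya0 byaw0] := w_sing _ ya0; exists b.
    by move=> by0; apply: bya0; rewrite [b *: _]mulrA [b * y]by0 mul0r.
  by rewrite mulrA -[b *: y * a]mulrA.
have add_sing (w w' : A) :
    left_singular w -> left_singular w' -> left_singular (w + w').
  move=> w_sing w'_sing y y0; have [a ay0 ayw0] := w_sing y y0.
  have [b bay0 bayw0] := w'_sing _ ay0; exists (b * a); rewrite -scalerA //.
  by rewrite mulrDr bayw0 addr0 -mulrA ayw0 mulr0.
have [|| g g_sing gP] := @left_ideal_generator left_singular.
- by move=> y y0; exists 1; rewrite scale1r // mulr0.
- by move=> a w w' w_sing w'_sing; apply: add_sing => //; apply: mulL_sing.
suff g0 : g = 0 by have [a ->] := gP z z_sing; rewrite g0 mulr0.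
have /choice[F FP] n : exists N : submodClosed A^o,
    forall y, y \in N <-> (y : A) * g ^+ n = 0.
  apply: submod_of_closed => [|a x y x0 y0]; first by rewrite mul0r.
  by rewrite mulrDl -mulrA x0 y0 mulr0 addr0.
have [n y | n nP] := @regular_noetherian F.
  by rewrite !FP exprSr mulrA => ->; rewrite mul0r.
apply: (@nilpotent_generator g n) => [a|].
  apply: gP => y y0; have [b by0 byg0] := g_sing y y0; exists b => //.
  by rewrite mulrA byg0 mul0r.
apply: contrapT => gn0; have [a agn0 agng0] := g_sing _ gn0.
by apply: agn0; apply/FP/nP/FP; rewrite exprSr mulrA.
Qed.

(** For W essential and y <> 0, some nonzero a y is of the form b c.  If no
multiple of b lying in W had a nonzero product with c, then b c would be left
singular.  Hence right multiplication by c preserves essential left ideals. *)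
Lemma regular_of_essential (c : A) :
  @essential A A^o (fun x => exists a : A, x = a * c) ->
  forall x, x * c = 0 -> x = 0.
Proof.
move=> c_ess.
have [||| f fE] := @linear_of_relation A A^o A^o (fun x y => y = (x : A) * c).
- by move=> x; exists ((x : A) * c).
- by move=> y ->; rewrite mul0r.
- by move=> a x y x' y' -> ->; rewrite [RHS]mulrDl -mulrA.
move=> x xc0.
apply: (injective_of_essential_image (f := f)); last by rewrite fE.
  exact: regular_noetherian.
move=> W W_ess y y0; have [a ay0 [b ayE]] := c_ess y y0.
apply: contrapT => noW; apply: ay0; rewrite ayE.
apply: left_singular0 => u u0; have [ub0 | ub0] := EM ((u : A) * b = 0).
  by exists 1; rewrite scale1r // mulrA ub0 mul0r.
have [d dub0 Wdub] := W_ess _ ub0; exists d.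
  by move=> du0; apply: dub0; rewrite [d *: _]mulrA [d * u]du0 mul0r.
apply: contrapT => dubc0; apply: noW.
have duE : (d * u * a) *: y = (d * (u * b) * c : A^o).
  by rewrite -scalerA ayE [LHS]mulrA -!mulrA.
exists (d * u * a); first by rewrite duE -!mulrA; rewrite -!mulrA in dubc0.
by exists (d *: ((u : A) * b : A^o)); rewrite ?fE.
Qed.

(** Equivalently, A p is projective: x p |-> x e splits the epimorphism
x |-> x p from A onto A p. *)
Lemma annihilator_idempotent (p : A) :
  exists2 e, e * p = p & forall x, x * p = 0 -> x * e = 0.
Proof.
have [|| N NP] := @submod_of_closed A A^o (fun x => exists a : A, x = a * p).
- by exists 0; rewrite mul0r.
- by move=> a _ _ [b ->] [c ->]; exists (a * b + c); rewrite mulrDl -mulrA.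
have [J [NJ0 NJ_ess]] := complement_exists N.
(* c generates A p + J, and c = a p + j *)
have [|| c [_ [j [/NP[a ->] Jj cE]]] c_gen] :=
  @left_ideal_generator
    (fun x => exists y z, [/\ y \in N, z \in J & x = y + z]).
- by exists 0, 0; rewrite !rpred0 addr0.
- move=> a _ _ [y [z [Ny Jz ->]]] [y' [z' [Ny' Jz' ->]]].
  exists ((a : A) *: y + y'), ((a : A) *: z + z').
  by rewrite !rpredD ?rpredZ // mulrDr addrACA.
have c_reg : forall x, x * c = 0 -> x = 0.
  apply: regular_of_essential => x x0.
  by have [b bx0 /c_gen bxE] := NJ_ess x x0; exists b.
have [|b pE] := c_gen p.
  exists p, 0; rewrite rpred0 addr0; split=> //.
  by apply/NP; exists 1; rewrite mul1r.
(* p - b a p = b j lies both in A p and in J *)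
exists (b * a) => [|x xp0].
  apply/esym/eqP; rewrite -subr_eq0; apply/eqP; apply: NJ0.
    by apply/NP; exists (1 - b * a); rewrite mulrBl mul1r.
  have -> : p - b * a * p = b *: (j : A^o).
    by rewrite {1}pE cE mulrDr mulrA addrAC subrr add0r.
  exact: rpredZ.
by rewrite mulrA (c_reg (x * b)) ?mul0r // -mulrA -pE.
Qed.

End SemiprimePrincipalRings.

(** * Endomorphisms and traces of left ideals *)

Section EndomorphismTheory.
Variables (R : pzRingType) (M : lmodType R).
Local Notation E := (endo M).

Lemma endo_appP (f : E) a x y :
  endo_app f (a *: x + y) = a *: endo_app f x + endo_app f y.
Proof. exact: linearP. Qed.

Lemma endo_appZ (f : E) a x : endo_app f (a *: x) = a *: endo_app f x.
Proof. exact: linearZ. Qed.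

Lemma endo_app_sum (f : E) n (F : 'I_n -> M) :
  endo_app f (\sum_(i < n) F i) = \sum_(i < n) endo_app f (F i).
Proof. exact: raddf_sum. Qed.

Lemma endo_app0 (f : E) : endo_app f 0 = 0.
Proof. exact: raddf0. Qed.

Lemma endo_app_mul (f g : E) x : endo_app (f * g) x = endo_app g (endo_app f x).
Proof. by []. Qed.

Lemma endo_app_sub (f g : E) x :
  endo_app (f - g) x = endo_app f x - endo_app g x.
Proof. by []. Qed.

Lemma endo_factor (f : E) (N : submodClosed M) (p : {linear M -> submod N})
    (s : {linear submod N -> M}) :
  (forall n, p (s n) = n) -> (forall x, endo_app f x \in N) ->
  exists h : E, forall x, endo_app f x = val (p (endo_app h x)).
Proof.
move=> psK fN; have [f' f'E] := corestriction (f := f : {linear M -> M}) fN.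
exists (s \o f' : {linear M -> M}) => x.
by rewrite /endo_app /= psK f'E.
Qed.

(** Put K' = f ^-1 (K).  Then f embeds M / K' into M / K, and g induces a map
M -> M / K', which lifts along M -> M / K' by quasi projectivity. *)
Lemma lift_modulo (K : submodClosed M) (f g : E) :
  quasi_projective M ->
  (forall x, exists y, endo_app g x - endo_app f y \in K) ->
  exists h : E, forall x, endo_app g x - endo_app f (endo_app h x) \in K.
Proof.
move=> Mqp gfK.
have [||K' K'P] := @submod_of_closed R M (fun y => endo_app f y \in K).
- by rewrite endo_app0 rpred0.
- by move=> a x y Kx Ky; rewrite endo_appP rpredD // rpredZ.
have [W [pi [pi_surj piP]]] := quotient_exists K'.
have [|||g' g'P] := @linear_of_relation R M W
  (fun x w => exists2 y, endo_app g x - endo_app f y \in K & w = pi y).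
- by move=> x; have [y Ky] := gfK x; exists (pi y), y.
- move=> _ [y Ky ->]; apply/piP/K'P; move: Ky.
  by rewrite endo_app0 sub0r => /submodN; rewrite opprK.
- move=> a x _ x' _ [y Ky ->] [y' Ky' ->]; exists (a *: y + y').
    by rewrite !endo_appP opprD addrACA -scalerBr rpredD // rpredZ.
  by rewrite linearP.
have [h hP] := Mqp W pi pi_surj g'.
exists h => x; have [y Ky yE] := g'P x.
have /K'P : endo_app h x - y \in K' by apply/piP; rewrite raddfB /= hP yE subrr.
rewrite -[_ - y]addrC -scaleN1r endo_appP scaleN1r addrC => Kfhy.
have := submodB Ky Kfhy; rewrite opprB addrA subrK.
exact.
Qed.

Fixpoint in_sum_images (s : seq E) (x : M) : Prop :=
  if s is f :: s' then exists y, in_sum_images s' (x - endo_app f y) else x = 0.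

Lemma in_sum_images_closed s :
  exists N : submodClosed M, forall x, x \in N <-> in_sum_images s x.
Proof.
apply: submod_of_closed.
  by elim: s => //= f s IHs; exists 0; rewrite endo_app0 subr0.
elim: s => [a x y -> -> | f s IHs a x y [u xu] [v yv]] /=.
  by rewrite scaler0 addr0.
exists (a *: u + v); rewrite endo_appP opprD addrACA -scalerBr.
exact: IHs.
Qed.

Lemma in_sum_images_catl s t x : in_sum_images s x -> in_sum_images (s ++ t) x.
Proof.
elim: s x => [|f s IHs] x /=; last by move=> [y /IHs]; exists y.
by move=> ->; have [N NP] := in_sum_images_closed t; apply/NP; apply: rpred0.
Qed.

Lemma in_sum_images_catr s t x : in_sum_images t x -> in_sum_images (s ++ t) x.
Proof.
elim: s => //= f s IHs /IHs xs.
by exists 0; rewrite endo_app0 subr0.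
Qed.

Definition trace (I : submodClosed E^o) (x : M) : Prop :=
  exists2 s : seq E, (forall f, f \in s -> f \in I) & in_sum_images s x.

Lemma trace_closed (I : submodClosed E^o) :
  exists N : submodClosed M, forall x, x \in N <-> trace I x.
Proof.
apply: submod_of_closed; first by exists [::].
move=> a x y [s sI xs] [t tI yt]; exists (s ++ t).
  by move=> f; rewrite mem_cat => /orP[/sI | /tI].
have [N NP] := in_sum_images_closed (s ++ t); apply/NP.
rewrite rpredD ?rpredZ //; apply/NP.
  exact: in_sum_images_catl.
exact: in_sum_images_catr.
Qed.

Lemma trace_image (I : submodClosed E^o) (f : E) x :
  f \in I -> trace I (endo_app f x).
Proof.
move=> If; exists [:: f]; first by move=> g; rewrite inE => /eqP->.
by exists x; rewrite /= subrr.
Qed.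

(** Induction on s = f :: s': modulo the sum of the images over s', the map g
factors through f by some h, and then g - h f has image in that smaller
sum. *)
Lemma mem_of_in_sum_images (I : submodClosed E^o) s (g : E) :
  quasi_projective M -> (forall f, f \in s -> f \in I) ->
  (forall x, in_sum_images s (endo_app g x)) -> g \in I.
Proof.
move=> Mqp; elim: s g => [|f s IHs] g sI gs /=.
  by have -> : g = 0 by [apply: endoP => x; rewrite gs]; apply: rpred0.
have [K KP] := in_sum_images_closed s.
have [|h hP] := @lift_modulo K f g Mqp.
  by move=> x; have [y ys] := gs x; exists y; apply/KP.
rewrite -[g](subrK (h * f)); apply: rpredD.
  apply: IHs => [f' sf' | x]; first by apply: sI; rewrite inE sf' orbT.
  by apply/KP; rewrite endo_app_sub endo_app_mul.
by apply: (rpredZ (h : E)); apply: sI; rewrite mem_head.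
Qed.

(** Finite generation of M bounds the image of g by the sum of the images of
finitely many members of I. *)
Lemma mem_of_trace (I : submodClosed E^o) (g : E) :
  quasi_projective M -> finitely_generated M ->
  (forall x, trace I (endo_app g x)) -> g \in I.
Proof.
move=> Mqp [t t_gen] gI.
suff [s sI gs] : exists2 s : seq E, (forall f, f \in s -> f \in I) &
    forall x, x \in t -> in_sum_images s (endo_app g x).
  apply: (mem_of_in_sum_images Mqp sI) => x.
  have [K KP] := in_sum_images_closed s; apply/KP.
  have [c ->] := t_gen x.
  rewrite endo_app_sum; apply: rpred_sum => i _; rewrite endo_appZ.
  by apply: rpredZ; apply/KP/gs/mem_nth.
elim: t {t_gen} => [|x t [s sI gs]]; first by exists [::].
have [s' s'I gs'] := gI x; exists (s' ++ s).
  by move=> f; rewrite mem_cat => /orP[/s'I | /sI].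
move=> y; rewrite inE => /predU1P[-> | ty]; first exact: in_sum_images_catl.
by apply: in_sum_images_catr; apply: gs.
Qed.

Lemma endo_onto_cyclic (x : M) :
  one_epi_retractable M ->
  exists2 f : E, (forall y, exists a, endo_app f y = a *: x) &
    exists y, endo_app f y = x.
Proof.
move=> Mretr.
have [||N NP] := @submod_of_closed R M (fun y => exists a, y = a *: x).
- by exists 0; rewrite scale0r.
- move=> a _ _ [b ->] [c ->]; exists (a * b + c).
  by rewrite scalerA scalerDl.
have [|f f_surj] := Mretr N; first by exists x.
exists (val \o f : {linear M -> M}).
  by move=> y; apply/NP/val_in.
have Nx : x \in N by apply/NP; exists 1; rewrite scale1r.
by have [y yE] := f_surj (Submod Nx); exists y; rewrite /endo_app /= yE.
Qed.

(** * From virtual semisimplicity to the endomorphism ring *)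

Section VirtuallySemisimple.
Hypotheses (Mqp : quasi_projective M) (Mfg : finitely_generated M).
Hypotheses (Mretr : one_epi_retractable M) (Mvs : virtually_semisimple M).

Lemma virtually_semisimple_endo_principal : principal_left_ideal_ring E.
Proof.
move=> I; have [N NP] := trace_closed I.
have [p [s psK]] := (virtually_semisimpleP M).1 Mvs N.
pose g : E := (val \o p : {linear M -> M}).
have Ig : g \in I.
  by apply: mem_of_trace => // x; apply/NP; apply: val_in.
exists g => f; split=> [If | [h ->]]; last exact: rpredZ.
have [|h hP] := endo_factor (f := f) psK.
  by move=> x; apply/NP; apply: trace_image.
by exists h; apply: endoP.
Qed.

Lemma virtually_semisimple_noetherian : noetherian M.
Proof.
apply: noetherian_of_epi => // N.
have [p [s psK]] := (virtually_semisimpleP M).1 Mvs N.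
by exists p => n; exists (s n).
Qed.

(** The section makes p preserve essential submodules: for y <> 0, choose a with
a y nonzero in N, then a multiple b s (a y), nonzero in W, whose image under p
is b a y. *)
Lemma injective_onto_essential (N : submodClosed M)
    (p : {linear M -> submod N}) (s : {linear submod N -> M}) :
  (forall n, p (s n) = n) -> essential (fun x => x \in N) ->
  forall x, p x = 0 -> x = 0.
Proof.
move=> psK N_ess x px0.
apply: (injective_of_essential_image (f := (val \o p : {linear M -> M}))).
- exact: virtually_semisimple_noetherian.
- move=> W W_ess y y0; have [a ay0 Nay] := N_ess y y0.
  have say0 : s (Submod Nay) <> 0.
    move=> say0; apply: ay0.
    by rewrite -[a *: y]/(val (Submod Nay)) -[Submod Nay]psK say0 !raddf0.
  have [b bsay0 Wb] := W_ess _ say0.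
  have bayE : (b * a) *: y = val (p (b *: s (Submod Nay))).
    by rewrite linearZ psK -scalerA.
  exists (b * a); last by exists (b *: s (Submod Nay)).
  move=> bay0; apply: bsay0; rewrite -linearZ.
  suff -> : b *: Submod Nay = 0 by rewrite raddf0.
  by apply: val_inj; rewrite -[RHS]/(0 : M) -bay0 -scalerA.
- by rewrite /= px0.
Qed.

(** If the right annihilator J of I contains an injective endomorphism, then
I = 0; the retraction of M onto the trace of J is one, as that trace is
essential. *)
Lemma virtually_semisimple_endo_semiprime : semiprime_ring E.
Proof.
move=> I [_ I_ideal] II0 g Ig.
have mulI0 f h : f \in I -> h \in I -> f * h = 0.
  move=> If Ih; apply: II0; exists [:: (f, h)]; split; last by rewrite big_seq1.
  by move=> q; rewrite inE => /eqP->.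
have [||J JP] := @submod_of_closed E E^o
  (fun f => forall h, h \in I -> h * f = 0).
- by move=> h _; rewrite mulr0.
- move=> a f f' f0 f'0 h Ih; rewrite mulrDr f'0 // addr0 mulrA f0 //.
  by have [] := I_ideal a h Ih.
have [N NP] := trace_closed J.
(* With f : M ->> R x, either f is in J, or some h in I has h f nonzero, and h f
   is in J because I I = 0; both f and h f have their images in R x. *)
have N_ess : essential (fun x => x \in N).
  move=> x x0; have [f fx [y yE]] := endo_onto_cyclic x Mretr.
  have [If0 | nIf0] := EM (forall h, h \in I -> h * f = 0).
    exists 1; rewrite scale1r //; apply/NP; rewrite -yE.
    by apply: trace_image; apply/JP.
  have [h [Ih hf0]] : exists h, h \in I /\ h * f <> 0.
    apply: contrapT => nex; apply: nIf0 => h Ih; apply: contrapT => hf0.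
    by apply: nex; exists h.
  have [z hfz0] : exists z, endo_app (h * f) z <> 0.
    apply: contrapT => nex; apply: hf0; apply: endoP => z.
    by apply: contrapT => hfz0; apply: nex; exists z.
  have [a hfzE] := fx (endo_app h z); exists a; first by rewrite -hfzE.
  rewrite -hfzE; apply/NP; apply: (@trace_image J (h * f)).
  by apply/JP => k Ik; rewrite mulrA (mulI0 k h Ik Ih) mul0r.
have [p [s psK]] := (virtually_semisimpleP M).1 Mvs N.
pose f : E := (val \o p : {linear M -> M}).
have Jf : f \in J by apply: mem_of_trace => // x; apply/NP; apply: val_in.
apply: endoP => x; apply: (injective_onto_essential psK N_ess).
apply: val_inj; rewrite -[LHS]/(endo_app (g * f) x).
by rewrite ((JP f).1 Jf g Ig).
Qed.

End VirtuallySemisimple.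

(** * From the endomorphism ring to virtual semisimplicity *)

Lemma virtually_semisimple_of_endo :
  one_epi_retractable M -> semiprime_ring E -> principal_left_ideal_ring E ->
  virtually_semisimple M.
Proof.
move=> Mretr E_semiprime E_plir; apply/virtually_semisimpleP => N.
have [|| p pN p_gen] := @left_ideal_generator E E_plir
  (fun f => forall x, endo_app f x \in N).
- by move=> x; apply: rpred0.
- by move=> a f g fN gN x; apply: rpredD; [apply: fN | apply: gN].
have [e epE pe0] := annihilator_idempotent E_semiprime E_plir p.
have p_onto n : n \in N -> exists x, n = endo_app p x.
  move=> Nn; have [f fn [y yE]] := endo_onto_cyclic n Mretr.
  have [|h fE] := p_gen f.
    by move=> x; have [a ->] := fn x; apply: rpredZ.
  by exists (endo_app h y); rewrite -yE fE.
(* Apply the choice of e to an endomorphism mapping M onto R x. *)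
have ker_p x : endo_app p x = 0 -> endo_app e x = 0.
  move=> px0; have [f fx [y yE]] := endo_onto_cyclic x Mretr.
  rewrite -yE -endo_app_mul pe0 //; apply: endoP => z.
  have [a fzE] := fx z.
  by rewrite endo_app_mul fzE endo_appZ px0 scaler0.
have [p' p'E] := corestriction (f := p : {linear M -> M}) pN.
have [|||s sP] := @linear_of_relation R (submod N) M
  (fun n y => exists2 x, val n = endo_app p x & y = endo_app e x).
- move=> n; have [x nE] := p_onto _ (val_in n).
  by exists (endo_app e x), x.
- by move=> _ [x /esym px0 ->]; apply: ker_p.
- move=> a n _ n' _ [x nE ->] [x' n'E ->]; exists (a *: x + x').
    by rewrite endo_appP -nE -n'E.
  by rewrite endo_appP.
exists p', s => n; have [x nE ->] := sP n.
by apply: val_inj; rewrite p'E nE -[RHS]/(endo_app p x) -{2}epE.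
Qed.

End EndomorphismTheory.

Theorem theorem2p9 (R : pzRingType) (M : lmodType R)
  (Mqp : quasi_projective M) (Mfg : finitely_generated M)
  (Mretr : one_epi_retractable M) :
  virtually_semisimple M <->
  semiprime_ring (endo M) /\ principal_left_ideal_ring (endo M).
Proof.
split=> [Mvs | [E_semiprime E_plir]]; last exact: virtually_semisimple_of_endo.
split; first exact: virtually_semisimple_endo_semiprime.
exact: virtually_semisimple_endo_principal.
Qed.
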